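(* Let $\Theta\subseteq\mathbb{R}$ be an interval and let $g:\Theta\to\mathbb{R}$ be a function whose third derivative $g'''$ exists, such that the equation $g(\theta)=0$, $\theta\in\Theta$, has a unique root $\theta^*$, with $g(\theta)>0$ for all $\theta<\theta^*$ and $g(\theta)<0$ for all $\theta>\theta^*$ ($\theta\in\Theta$). Let $b_3$ be a constant with $g'''(\theta)\ge b_3$ for all $\theta\in\Theta$, and let, for $\theta,\theta^{(t)}\in\Theta$, $$U(\theta|\theta^{(t)})=g(\theta^{(t)})+(\theta-\theta^{(t)})g'(\theta^{(t)})+\frac{(\theta-\theta^{(t)})^2}{2}g''(\theta^{(t)})+\frac{b_3}{6}(\theta-\theta^{(t)})^3.$$ Then the US iteration $$\theta^{(t+1)}=h(\theta^{(t)}),\qquad h(\theta^{(t)}):=\text{the solution in }\theta\in\Theta\text{ of }U(\theta|\theta^{(t)})=0,$$ has a cubic convergence rate given by $$\lim_{t\to\infty}\frac{|\theta^{(t+1)}-\theta^*|}{|\theta^{(t)}-\theta^*|^3}=\frac{|h'''(\theta^* )|}{6}=\left|\frac{b_3-g'''(\theta^* )}{6g'(\theta^* )}\right|\in(0,\infty).$$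
   Context: The constant $b_3$ is called the third-derivative lower bound (TLB) constant. The iteration starts from an initial value $\theta^{(0)}\in\Theta$.
   Formalization: Assumes in addition that the initial value differs from θ*, that g'(θ* ) ≠ 0 and that b_3 ≠ g'''(θ* ); the equality with |h'''(θ* )|/6 is stated only when h'''(θ* ) exists, which existence of g''' alone does not ensure. *)

(* Defs.v *)
(* MathComp-Analysis. *)
From HB Require Import structures.
From mathcomp Require Import all_boot all_order all_algebra.
From mathcomp Require Import all_classical all_reals all_analysis.

Set Implicit Arguments.
Unset Strict Implicit.
Unset Printing Implicit Defensive.

Import Order.TTheory GRing.Theory Num.Theory.
Import numFieldNormedType.Exports.

Local Open Scope classical_set_scope.
Local Open Scope ring_scope.

(* A function on D is represented by a total function of which only the values
   on D matter.  Its derivative is taken relative to D: it is one-sided at an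
   endpoint of D and is the usual derivative at an interior point. *)
Definition diff_quot {R : realType} (f : R -> R) (x y : R) : R :=
  (f y - f x) / (y - x).

Definition derivable_on {R : realType} (D : set R) (f : R -> R) (x : R) : Prop :=
  cvg (diff_quot f x y @[y --> within D x^']).

Definition derive_on {R : realType} (D : set R) (f : R -> R) (x : R) : R :=
  lim (diff_quot f x y @[y --> within D x^']).

Definition derive_onn {R : realType} (D : set R) (n : nat) (f : R -> R) :
  R -> R := iter n (derive_on D) f.

(* The n-th derivative at x is the derivative at x of the one of order n - 1, so
   those of lower order have to exist on a neighborhood of x in D. *)
Definition derivable_onn {R : realType} (D : set R) (n : nat) (f : R -> R)
    (x : R) : Prop :=
  forall k : nat, (k < n)%N ->
    derivable_on D (derive_onn D k f) x /\
    ((k.+1 < n)%N ->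
      \forall y \near x, D y -> derivable_on D (derive_onn D k f) y).

Definition TLB_constant {R : realType} (D : set R) (g : R -> R) (b3 : R) :
  Prop := forall x : R, D x -> b3 <= derive_onn D 3 g x.

(* [US_U D g b3 x y] is U(y|x): x is the current iterate, y the unknown. *)
Definition US_U {R : realType} (D : set R) (g : R -> R) (b3 x y : R) : R :=
  g x + (y - x) * derive_onn D 1 g x
  + (y - x) ^+ 2 / 2 * derive_onn D 2 g x
  + b3 / 6 * (y - x) ^+ 3.

(* h x is "the" solution: U(.|x) has exactly one zero in D. *)
Definition US_map {R : realType} (D : set R) (g : R -> R) (b3 : R)
    (h : R -> R) : Prop :=
  forall x : R, D x -> [set y | D y /\ US_U D g b3 x y = 0] = [set h x].

Definition cubic_convergence {R : realType} (u : nat -> R) (l c : R) : Prop :=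
  (u t @[t --> \oo] --> l) /\
  (`|u t.+1 - l| / `|u t - l| ^+ 3 @[t --> \oo] --> c).

(* Main.v *)
(* For fixed x the gap G = g - U(.|x) has G(x) = G'(x) = G''(x) = 0 and
   G''' = g''' - b3 >= 0, so it is nondecreasing on Theta; it cannot vanish at
   theta* for x <> theta*, since it would then vanish between x and theta* and
   g'''(theta* ) = b3.  Hence h(x) lies strictly between x and theta*, and the
   iterates converge monotonically; the limit is a zero of g by continuity of
   g, g', g''.
   As g''' need not be continuous, the rate comes from the expansions with Peano
   remainder of g, g', g'' at theta*: inserted in U(h(x)|x) = 0, they give
   h(x) - theta* = c (x - theta* )^3 + o((x - theta* )^3), which also determines
   h'''(theta* ) when it exists. *)
Require Import Defs.
From HB Require Import structures.
From mathcomp Require Import all_boot all_order all_algebra.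
From mathcomp Require Import all_classical all_reals all_analysis.
From mathcomp Require Import ring lra.

Set Implicit Arguments.
Unset Strict Implicit.
Unset Printing Implicit Defensive.

Import Order.TTheory GRing.Theory Num.Theory.
Import numFieldNormedType.Exports.

Local Open Scope classical_set_scope.
Local Open Scope ring_scope.

(** This is [r = o(|x - a|^n)] along [D]. The neighborhoods of [a] are not punctured, so it forces
    [r a = 0] whenever [D a]. *)
Definition little_pow {R : realType} (D : set R) (a : R) (n : nat)
    (r : R -> R) : Prop :=
  forall e : R, 0 < e -> \forall x \near a, D x -> `|r x| <= e * `|x - a| ^+ n.

(** The quotient-free form lets the rules for sums and multiples follow from those for
    remainders. *)
Definition has_derive_on {R : realType} (D : set R) (f : R -> R) (x l : R) :
    Prop :=
  little_pow D x 1 (fun y => f y - f x - l * (y - x)).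

(** * Calculus of Peano remainders relative to a set *)

Section LittlePow.
Context {R : realType}.
Implicit Types (D : set R) (a x l c : R) (n m : nat) (f r s : R -> R).

Lemma little_pow_ext D a n r s :
  (forall x, D x -> r x = s x) -> little_pow D a n r -> little_pow D a n s.
Proof.
by move=> rs hr e e0; apply: filterS (hr e e0) => x hx Dx; rewrite -rs ?hx.
Qed.

Lemma little_pow_sub D E a n r :
  E `<=` D -> little_pow D a n r -> little_pow E a n r.
Proof. by move=> ED hr e e0; apply: filterS (hr e e0) => x hx /ED. Qed.

Lemma little_powD D a n r s : little_pow D a n r -> little_pow D a n s ->
  little_pow D a n (fun x => r x + s x).
Proof.
move=> hr hs e e0; have e20 : 0 < e / 2 by rewrite divr_gt0.
apply: filterS2 (hr _ e20) (hs _ e20) => x hx kx Dx.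
have := hx Dx; have := kx Dx; have := ler_normD (r x) (s x).
by have := exprn_ge0 n (normr_ge0 (x - a)); set u := _ ^+ n; lra.
Qed.

(** Near [a] the extra factor [|x - a|] is at most [e / (|c| + 1)]; the sign of [c] is arbitrary. *)
Lemma little_pow_bigO D a n r c :
  (\forall x \near a, D x -> `|r x| <= c * `|x - a| ^+ n.+1) ->
  little_pow D a n r.
Proof.
move=> hr e e0.
have c0 : 0 < `|c| + 1 by rewrite ltr_wpDl.
have d0 : 0 < e / (`|c| + 1) by rewrite divr_gt0.
have hx : \forall x \near a, `|a - x| <= e / (`|c| + 1).
  have /cvgrPdist_le := @cvg_id _ (nbhs a); exact.
apply: filterS2 hr hx => x hx xa Dx; apply: (le_trans (hx Dx)).
rewrite exprS mulrA ler_wpM2r // ?exprn_ge0 //.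
rewrite distrC ler_pdivlMr // in xa.
have := ler_norm c; have := normr_ge0 (x - a); set u := `|x - a| in xa *.
by move=> u0 cc; nra.
Qed.

(** The constant 1 in the bound on [s] fits the estimates of [h x - a] and [h x - x] by
    [|x - a|]. *)
Lemma little_powM D a n m r s :
  (\forall x \near a, D x -> `|s x| <= `|x - a| ^+ m) ->
  little_pow D a n r -> little_pow D a (m + n) (fun x => s x * r x).
Proof.
move=> hs hr e e0; apply: filterS2 hs (hr e e0) => x hx kx Dx.
rewrite normrM exprD mulrCA ler_pM //; [exact: hx|exact: kx].
Qed.

Lemma little_powZ D a n c r : little_pow D a n r ->
  little_pow D a n (fun x => c * r x).
Proof.
move=> hr e e0; have c0 : 0 < `|c| + 1 by rewrite ltr_wpDl.
have d0 : 0 < e / (`|c| + 1) by rewrite divr_gt0.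
apply: filterS (hr _ d0) => x hx Dx; rewrite normrM.
have := hx Dx; set u := e / _; have eu : e = u * (`|c| + 1).
  by rewrite /u divfK // gt_eqF.
rewrite eu; have := exprn_ge0 n (normr_ge0 (x - a)).
set v := _ ^+ n => v0; move: d0 (normr_ge0 c) (normr_ge0 (r x)).
rewrite -/u; set k := `|c|; set w := `|r x| => u0 k0 w0 wu.
have -> : u * (k + 1) * v = k * (u * v) + u * v by ring.
have := ler_wpM2l k0 wu; have := mulr_ge0 (ltW u0) v0; lra.
Qed.

Lemma little_powB D a n r s : little_pow D a n r -> little_pow D a n s ->
  little_pow D a n (fun x => r x - s x).
Proof.
move=> hr /(little_powZ (-1)) hs.
by apply: little_pow_ext (little_powD hr hs) => x _; rewrite mulN1r.
Qed.

Lemma little_pow_weak D a n r : little_pow D a n.+1 r -> little_pow D a n r.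
Proof.
move=> hr; apply: (little_pow_bigO (c := 1)); exact: (hr 1 ltr01).
Qed.

Lemma little_pow_le D a n m r : (n <= m)%N ->
  little_pow D a m r -> little_pow D a n r.
Proof.
move=> /subnK <-; elim: (m - n)%N => // k IH; rewrite addSn => hr.
exact/IH/little_pow_weak.
Qed.

Lemma little_pow_exp D a n c : little_pow D a n (fun x => c * (x - a) ^+ n.+1).
Proof.
apply: (little_pow_bigO (c := `|c|)); apply: (@filterE _ (nbhs a)) => x _.
by rewrite normrM normrX.
Qed.

(** With [e = |c| / 2], a point [x != a] of [D] close to [a] would give [|c| <= |c| / 2]. *)
Lemma little_pow_leadP D a n c :
  (forall e, 0 < e -> exists2 x, D x /\ x != a & `|x - a| < e) ->
  little_pow D a n (fun x => c * (x - a) ^+ n) -> c = 0.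
Proof.
move=> acc hc; apply/eqP/negPn/negP => c0.
have c20 : 0 < `|c| / 2 by rewrite divr_gt0 ?normr_gt0.
have /nbhs_ballP[e /= e0 he] := hc _ c20.
have [x [Dx xa] xe] := acc _ e0.
have /(_ Dx) := he x (etrans (congr1 (fun u => u < e) (distrC _ _)) xe).
rewrite normrM normrX ler_pM2r ?exprn_gt0 ?normr_gt0 ?subr_eq0 //.
by have : 0 < `|c|; [rewrite normr_gt0|lra].
Qed.

End LittlePow.

(** * Derivatives relative to a set, the mean value theorem and Taylor expansions with Peano
    remainder *)

Section DeriveOn.
Context {R : realType}.
Implicit Types (D : set R) (a x l c : R) (n m : nat) (f g r s : R -> R).

Lemma derivable_onP D f x :
  derivable_on D f x -> has_derive_on D f x (derive_on D f x).
Proof.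
move=> /cvgrPdist_le fx e e0.
have := fx _ e0; rewrite near_withinE near_withinE.
apply: filterS => y hy Dy; rewrite expr1.
(* The punctured limit says nothing at [y = x], where the remainder is zero anyway. *)
have [->|yx] := eqVneq y x; first by rewrite !subrr mulr0 subrr normr0 mulr0.
have yx0 : y - x != 0 by rewrite subr_eq0.
rewrite -ler_pdivrMr ?normr_gt0 // -normf_div -normrN.
have := hy yx Dy; rewrite /diff_quot /= -/(derive_on D f x); congr (`|_| <= _).
by field.
Qed.

Lemma has_derive_on_continuous D f x l :
  has_derive_on D f x l -> f y @[y --> within D (nbhs x)] --> f x.
Proof.
move=> fx; apply/cvgrPdist_le => e e0; rewrite near_withinE.
have h1 : little_pow D x 0 (fun y => f y - f x - l * (y - x)).
  exact: little_pow_weak fx.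
have h2 : little_pow D x 0 (fun y => l * (y - x) ^+ 1) by exact: little_pow_exp.
apply: filterS (little_powD h1 h2 e0) => y hy Dy.
by have := hy Dy; rewrite expr0 mulr1 expr1 distrC subrK.
Qed.

Lemma has_derive_on_sub D E f x l :
  E `<=` D -> has_derive_on D f x l -> has_derive_on E f x l.
Proof. by move=> ED; exact: little_pow_sub. Qed.

Lemma has_derive_on_eq D f g x l c : f =1 g -> l = c ->
  has_derive_on D f x l -> has_derive_on D g x c.
Proof. by move=> fg <-; apply: little_pow_ext => y _; rewrite !fg. Qed.

Lemma has_derive_onD D f g x l c : has_derive_on D f x l ->
  has_derive_on D g x c -> has_derive_on D (fun y => f y + g y) x (l + c).
Proof.
move=> fx gx; apply: little_pow_ext (little_powD fx gx) => y _; ring.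
Qed.

Lemma has_derive_onB D f g x l c : has_derive_on D f x l ->
  has_derive_on D g x c -> has_derive_on D (fun y => f y - g y) x (l - c).
Proof.
move=> fx gx; apply: little_pow_ext (little_powB fx gx) => y _; ring.
Qed.

Lemma has_derive_onZ D f x l c : has_derive_on D f x l ->
  has_derive_on D (fun y => c * f y) x (c * l).
Proof. move=> fx; apply: little_pow_ext (little_powZ c fx) => y _; ring. Qed.

Lemma has_derive_on_cst D x c : has_derive_on D (fun=> c) x 0.
Proof.
move=> e e0; apply: (@filterE _ (nbhs x)) => y _.
by rewrite mul0r !subrr normr0 mulr_ge0 ?exprn_ge0 // ltW.
Qed.

Lemma is_derive_has_derive_on D f x l :
  is_derive x 1 f l -> has_derive_on D f x l.
Proof.
move=> [+ +] e e0; rewrite /derivable /derive /= => fx lE.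
move/cvgrPdist_le : fx; rewrite lE => /(_ _ e0); rewrite near_withinE.
move=> h; apply/nbhs0P; apply: filterS h => y hy _; rewrite [x + y]addrC addrK expr1.
have [->|y0] := eqVneq y 0; first by rewrite add0r mulr0 !subrr normr0 mulr0.
have := hy y0; rewrite -(ler_pM2r (x := `|y|)) ?normr_gt0 // -normrM.
rewrite [y *: 1]mulr1 -normrN; congr (`|_| <= _).
by rewrite /GRing.scale /=; field.
Qed.

Lemma has_derive_on_is_derive D f x l :
  (\forall y \near x, D y) -> has_derive_on D f x l -> is_derive x 1 f l.
Proof.
move=> Dx fx.
have lE : h^-1 *: (f (h *: 1 + x) - f x) @[h --> 0^'] --> l.
  apply/cvgrPdist_le => e e0; rewrite near_withinE.
  have h : \forall y \near x, `|f y - f x - l * (y - x)| <= e * `|y - x| ^+ 1.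
    by apply: filterS2 Dx (fx _ e0) => y Dy; apply.
  move/nbhs0P : h => h.
  apply: filterS h => y /= hy y0.
  rewrite -(ler_pM2r (x := `|y|)) ?normr_gt0 // -normrM.
  move: hy; rewrite [x + y]addrC addrK expr1 [y *: 1]mulr1.
  rewrite -[`|_ - l * y|]normrN.
  by congr (`|_| <= _); rewrite /GRing.scale /=; field.
by split; [apply/cvg_ex; exists l|exact/cvg_lim].
Qed.

Lemma has_derive_onX D a n x :
  has_derive_on D (fun y => (y - a) ^+ n) x (n%:R * (x - a) ^+ n.-1).
Proof.
apply: is_derive_has_derive_on.
have h : is_derive x 1 (fun y => y - a) 1.
  by apply: is_derive_eq; rewrite subr0.
have := is_deriveX n h; rewrite /GRing.scale /= mulr1.
by congr is_derive; apply/funext => y; rewrite fctE.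
Qed.

Lemma has_derive_on_sum D n (F : nat -> R -> R) (dF : nat -> R) x :
  (forall k, has_derive_on D (F k) x (dF k)) ->
  has_derive_on D (fun y => \sum_(k < n) F k y) x (\sum_(k < n) dF k).
Proof.
move=> FdF; elim: n => [|n IH].
  by apply: has_derive_on_eq (has_derive_on_cst D x 0) => [y|]; rewrite big_ord0.
apply: has_derive_on_eq (has_derive_onD IH (FdF n)) => [y|];
  by rewrite big_ord_recr.
Qed.

(** Points strictly between [x] and [y] are interior to [D], so the relative derivative is the usual
    one there; at the ends it yields one-sided continuity. The two orders of [x] and [y] are covered
    at once, the sign condition keeping [c] on the side of [y]. *)
Lemma MVT_on D f (df : R -> R) x y : is_interval D -> D x -> D y ->
  (forall t, D t -> `|t - x| <= `|y - x| -> has_derive_on D f t (df t)) ->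
  exists c, [/\ D c, `|c - x| <= `|y - x|, 0 <= (c - x) * (y - x) &
    f y - f x = df c * (y - x)].
Proof.
move=> itvD.
have lt_case u v : D u -> D v -> u < v ->
    (forall t, u <= t <= v -> has_derive_on D f t (df t)) ->
    exists2 c, u < c < v & f v - f u = df c * (v - u).
  move=> Du Dv uv fdf.
  have [| |c cuv fE] := @MVT _ f df u v uv.
  - move=> t tuv; apply: (@has_derive_on_is_derive D).
      apply: filterS (near_in_itvoo tuv) => z; rewrite in_itv/= => /andP[uz zv].
      by apply: (itvD _ _ Du Dv); rewrite !ltW.
    by apply: fdf; move: tuv; rewrite in_itv/= => /andP[uz zv]; rewrite !ltW.
  - apply/subspace_continuousP => t /=; rewrite in_itv/= => tuv.
    apply: (@has_derive_on_continuous _ f t (df t)).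
    apply: has_derive_on_sub (fdf _ tuv) => z /=; rewrite in_itv/=.
    exact: itvD Du Dv z.
  by exists c => //; move: cuv; rewrite in_itv.
move=> Dx Dy fdf; have [xy|yx|->] := ltgtP x y.
- have [|c /andP[xc cy] fE] := lt_case _ _ Dx Dy xy.
    move=> t /andP[xt ty]; apply: fdf; first by apply: (itvD _ _ Dx Dy); rewrite xt.
    by rewrite !ger0_norm; lra.
  exists c; split => //; first by apply: (itvD _ _ Dx Dy); rewrite !ltW.
    by rewrite !ger0_norm; lra.
  by apply: mulr_ge0; lra.
- have [|c /andP[yc cx] fE] := lt_case _ _ Dy Dx yx.
    move=> t /andP[yt tx]; apply: fdf; first by apply: (itvD _ _ Dy Dx); rewrite yt.
    by rewrite !ler0_norm; lra.
  exists c; split => //; first by apply: (itvD _ _ Dy Dx); rewrite !ltW.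
  + by rewrite !ler0_norm; lra.
  + by apply: mulr_le0; lra.
  + by rewrite -opprB fE; ring.
- by exists y; split; rewrite ?subrr ?mulr0.
Qed.

(** The mean value theorem gives [r x = dr c * (x - a)] with [c] no farther from [a] than [x]. *)
Lemma little_pow_integrate D a n r (dr : R -> R) : is_interval D -> D a ->
  r a = 0 -> (\forall x \near a, D x -> has_derive_on D r x (dr x)) ->
  little_pow D a n dr -> little_pow D a n.+1 r.
Proof.
move=> itvD Da ra0 /nbhs_ballP[d /= d0 hd] hdr e e0.
have /nbhs_ballP[d' /= d'0 hd'] := hdr e e0.
apply/nbhs_ballP; exists (Num.min d d'); first by rewrite /= lt_min d0.
move=> x; rewrite /ball /= distrC lt_min => /andP[xd xd'] Dx.
have [t Dt ta|c [Dc ca _]] := @MVT_on D r dr a x itvD Da Dx.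
  by apply: hd => //; rewrite /ball /= distrC; apply: le_lt_trans xd.
rewrite ra0 subr0 => ->; rewrite normrM exprSr mulrA ler_wpM2r //.
apply: le_trans (hd' c _ Dc) _.
  by rewrite /ball /= distrC; apply: le_lt_trans xd'.
by rewrite ler_wpM2l ?(ltW e0) // lerXn2r ?nnegrE.
Qed.

(** By induction on [n]: near [a], the derivative of the remainder of [f] is the remainder of [f']
    of one order less, which is then integrated. *)
Lemma taylor_peano D a n f : is_interval D -> D a ->
  derivable_onn D n.+1 f a ->
  little_pow D a n.+1 (fun x =>
    f x - \sum_(k < n.+2) derive_onn D k f a / k`!%:R * (x - a) ^+ k).
Proof.
move=> itvD Da; elim: n f => [|n IH] f df.
  have [/derivable_onP h _] := df 0%N isT.
  apply: little_pow_ext h => x _.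
  by rewrite !big_ord_recr big_ord0 /= fact0 !divr1 expr0 expr1; ring.
have dSf k : derive_onn D k (derive_on D f) = derive_onn D k.+1 f.
  by rewrite /derive_onn iterSr.
have df' : derivable_onn D n.+1 (derive_on D f) a.
  by move=> k kn; rewrite dSf; exact: (df k.+1).
apply: little_pow_integrate (IH _ df') => //.
  rewrite big_ord_recl /= fact0 divr1 expr0 mulr1 big1 ?addr0 ?subrr//.
  by move=> i _; rewrite expr0n mulr0.
have [_ /(_ isT)] := df 0%N isT; apply: filterS => x hx Dx.
apply: has_derive_onB; first exact/derivable_onP/hx.
apply: has_derive_on_eq (has_derive_on_sum n.+3 (fun k =>
  has_derive_onZ (derive_onn D k f a / k`!%:R) (has_derive_onX D a k x))) => //.
(* The constant term drops out, and [(i + 1) / (i + 1)! = 1 / i!] shifts the sum by one. *)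
rewrite big_ord_recl /= mul0r mulr0 add0r; apply: eq_bigr => i _.
rewrite dSf /bump leq0n add1n factS natrM /= add0n -/(derive_onn D i.+1 f a).
have f0 : (i`!%:R != 0 :> R) by rewrite pnatr_eq0 -lt0n fact_gt0.
have i0 : (i.+1%:R != 0 :> R) by rewrite pnatr_eq0.
by field; rewrite f0 nat1r i0.
Qed.

End DeriveOn.

(** * Uniqueness of cubic expansions, and the expansion of the US map at a root *)

Section USMap.
Context {R : realType}.
Implicit Types (D : set R) (a b x y c : R) (g h : R -> R).

(** The point is [a + s (b - a)]: [s <= 1] keeps it in the interval, and the other bound on [s]
    keeps it within [e / 2] of [a]. *)
Lemma itv_accumulation D a b e : is_interval D -> D a -> D b -> b != a ->
  0 < e -> exists2 x, D x /\ x != a & `|x - a| < e.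
Proof.
move=> itvD Da Db ba e0; have ba0 : 0 < `|b - a| by rewrite normr_gt0 subr_eq0.
pose s := Num.min 1 (e / 2 / `|b - a|).
have s0 : 0 < s by rewrite lt_min ltr01 !divr_gt0.
have s1 : s <= 1 by rewrite ge_min lexx.
have se : s * `|b - a| <= e / 2 by rewrite -ler_pdivlMr // ge_min lexx orbT.
exists (a + s * (b - a)); last first.
  rewrite addrAC subrr add0r normrM (gtr0_norm s0). lra.
split; last by rewrite -subr_eq0 addrAC subrr add0r mulf_neq0 ?subr_eq0 ?(gt_eqF s0).
have [ab|ab|ab] := ltgtP a b; last by rewrite ab eqxx in ba.
- by apply: (itvD _ _ Da Db); apply/andP; split; nra.
- by apply: (itvD _ _ Db Da); apply/andP; split; nra.
Qed.

(** Coefficients are removed in increasing degree: at order [k] the terms of higher degree are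
    [o(|x - a|^k)], which isolates the leading one. *)
Lemma little_pow3_cubic D a c1 c2 c3 :
  (forall e, 0 < e -> exists2 x, D x /\ x != a & `|x - a| < e) ->
  little_pow D a 3
    (fun x => c1 * (x - a) + c2 * (x - a) ^+ 2 + c3 * (x - a) ^+ 3) ->
  [/\ c1 = 0, c2 = 0 & c3 = 0].
Proof.
move=> acc o3.
have o2 := little_pow_weak o3; have o1 := little_pow_weak o2.
have c10 : c1 = 0.
  apply: (little_pow_leadP (n := 1) acc).
  apply: little_pow_ext (little_powB o1 (little_powD (little_pow_exp D a 1 c2)
    (little_pow_weak (little_pow_exp D a 2 c3)))) => x _; ring.
have c20 : c2 = 0.
  apply: (little_pow_leadP (n := 2) acc).
  apply: little_pow_ext (little_powB o2 (little_pow_exp D a 2 c3)) => x _.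
  by rewrite c10; ring.
split=> //; apply: (little_pow_leadP (n := 3) acc).
by apply: little_pow_ext o3 => x _; rewrite c10 c20; ring.
Qed.

Lemma derivable_onnS D n f a : derivable_onn D n.+1 f a ->
  derivable_onn D n (derive_on D f) a.
Proof. by move=> df k kn; have := df k.+1 kn; rewrite /derive_onn !iterSr. Qed.

Lemma taylor_peano3 D g a : is_interval D -> D a -> derivable_onn D 3 g a ->
  little_pow D a 3 (fun x => g x - (g a + derive_onn D 1 g a * (x - a)
    + derive_onn D 2 g a / 2 * (x - a) ^+ 2
    + derive_onn D 3 g a / 6 * (x - a) ^+ 3)).
Proof.
move=> itvD Da dg; apply: little_pow_ext (taylor_peano itvD Da dg) => x _.
by rewrite !big_ord_recr big_ord0 /= !factS fact0 /=; field.
Qed.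

Lemma taylor_peano2 D g a : is_interval D -> D a -> derivable_onn D 2 g a ->
  little_pow D a 2 (fun x => g x - (g a + derive_onn D 1 g a * (x - a)
    + derive_onn D 2 g a / 2 * (x - a) ^+ 2)).
Proof.
move=> itvD Da dg; apply: little_pow_ext (taylor_peano itvD Da dg) => x _.
by rewrite !big_ord_recr big_ord0 /= !factS fact0 /=; field.
Qed.

(* Once the Taylor expansions at [a] are inserted, [U(h(x)|x) = 0] is solved for
   [h x - a]; feeding the current bound on [h x - a] back into the right-hand
   side improves it from o(|x - a|) to o(|x - a|^2), then to the claim. *)
Lemma US_map_expansion D g h b3 a : is_interval D -> D a ->
  derivable_onn D 3 g a -> g a = 0 -> derive_onn D 1 g a != 0 ->
  (forall x, D x -> US_U D g b3 x (h x) = 0) ->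
  (forall x, D x -> `|h x - a| <= `|x - a|) ->
  (forall x, D x -> `|h x - x| <= `|x - a|) ->
  little_pow D a 3 (fun x => h x - a -
    (b3 - derive_onn D 3 g a) / (6 * derive_onn D 1 g a) * (x - a) ^+ 3).
Proof.
move=> itvD Da dg ga0; set g1 := derive_onn D 1 g a => g10 Uh ha hx.
pose g2 := derive_onn D 2 g a; pose g3 := derive_onn D 3 g a; rewrite -/g3.
pose dg1 := derive_onn D 1 g; pose dg2 := derive_onn D 2 g.
pose r0 x := g x - (g a + g1 * (x - a) + g2 / 2 * (x - a) ^+ 2
  + g3 / 6 * (x - a) ^+ 3).
pose r1 x := dg1 x - (g1 + g2 * (x - a) + g3 / 2 * (x - a) ^+ 2).
pose r2 x := dg2 x - g2 - g3 * (x - a).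
have o0 : little_pow D a 3 r0 by exact: taylor_peano3.
have o1 : little_pow D a 2 r1.
  exact: (taylor_peano2 itvD Da (derivable_onnS dg)).
have o2 : little_pow D a 1 r2 by exact: (derivable_onP (dg 2%N isT).1).
(* All remainders as they enter [U(h(x)|x)]; the powers of [h x - x] make up for the lower orders of
   [r1] and [r2]. *)
pose r x := r0 x + ((h x - x) * r1 x + 2^-1 * ((h x - x) ^+ 2 * r2 x)).
have or : little_pow D a 3 r.
  apply: little_powD o0 (little_powD _ (little_powZ _ _)).
    apply: (little_powM (m := 1)) o1; apply: (@filterE _ (nbhs a)) => x.
    exact: hx.
  apply: (little_powM (m := 2)) o2; apply: (@filterE _ (nbhs a)) => x Dx.
  by rewrite normrX lerXn2r ?nnegrE // hx.
pose k := (b3 - g3) / 6; pose d x := h x - a.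
(* The Taylor polynomial of [g] at [a], re-expanded at [x] and evaluated at [h x], is a polynomial
   in [d x]. Replacing its cubic coefficient by [b3 / 6] adds [k (h x - x)^3]. The linear term
   [g1 * d x] is then isolated. *)
have dE x : D x -> d x = - g1^-1 * (g2 / 2 * (d x * d x)
    + g3 / 6 * (d x * (d x * d x)) + k * (h x - x) ^+ 3 + r x).
  move=> Dx; have := Uh x Dx; rewrite /US_U -/(dg1 x) -/(dg2 x) => U0.
  have gx : g x = r0 x + (g1 * (x - a) + g2 / 2 * (x - a) ^+ 2
    + g3 / 6 * (x - a) ^+ 3) by rewrite /r0 ga0; ring.
  have g1x : dg1 x = r1 x + (g1 + g2 * (x - a) + g3 / 2 * (x - a) ^+ 2).
    by rewrite /r1; ring.
  have g2x : dg2 x = r2 x + g2 + g3 * (x - a) by rewrite /r2; ring.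
  apply: (mulfI g10); rewrite [RHS]mulrA mulrN divff // mulN1r; apply/eqP.
  rewrite -subr_eq0 opprK -[X in _ == X]U0 gx g1x g2x /r /d /k; apply/eqP.
  by field.
have absd : \forall x \near a, D x -> `|d x| <= `|x - a| ^+ 1.
  by apply: (@filterE _ (nbhs a)) => x; exact: ha.
have ocube : little_pow D a 2 (fun x => (h x - x) ^+ 3).
  apply: (little_pow_bigO (c := 1)); apply: (@filterE _ (nbhs a)) => x Dx.
  by rewrite mul1r normrX lerXn2r ?nnegrE // hx.
(* In [dE] the last two terms are already [o(|x - a|^2)] and the cubic one is [d x] times the
   square, so a bound on the square passes to [d]. *)
have improve n : (n <= 2)%N -> little_pow D a n (fun x => d x * d x) ->
    little_pow D a n d.
  move=> n2 odd.
  apply: little_pow_ext (little_powZ (- g1^-1) (little_powD (little_powD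
    (little_powD (little_powZ (g2 / 2) odd) (little_powZ (g3 / 6)
      (little_pow_weak (little_powM absd odd))))
    (little_powZ k (little_pow_le n2 ocube)))
    (little_pow_le (leqW n2) or))) => x Dx; exact/esym/dE.
have od1 : little_pow D a 1 d.
  apply: improve => //; apply: (little_pow_bigO (c := 1)).
  apply: (@filterE _ (nbhs a)) => x Dx.
  by rewrite mul1r -expr2 normrX lerXn2r ?nnegrE // ha.
have od2 : little_pow D a 2 d by apply: improve => //; exact: (little_powM absd od1).
have odd : little_pow D a 3 (fun x => d x * d x).
  exact: (little_powM absd od2).
have absx : \forall x \near a, D x -> `|x - a| <= `|x - a| ^+ 1.
  by apply: (@filterE _ (nbhs a)).
have oxd : little_pow D a 3 (fun x => (x - a) * d x) by exact: (little_powM absx od2).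
(* With [h x - x = d x - (x - a)], every term of the cube except [- (x - a)^3] is [o(|x - a|^3)];
   that one, times [- k / g1], is the claimed leading term. *)
apply: little_pow_ext (little_powZ (- g1^-1) (little_powD (little_powD
  (little_powD (little_powZ (g2 / 2) odd) (little_powZ (g3 / 6)
    (little_pow_weak (little_powM absd odd))))
  (little_powZ k (little_powD (little_powB
    (little_pow_weak (little_powM absd odd))
    (little_powZ 3 (little_pow_weak (little_powM absx odd))))
    (little_powZ 3 (little_pow_weak (little_powM absx oxd)))))) or)) => x Dx.
by rewrite [in RHS]/= -/(d x) [in RHS]dE // -/(d x) /k /d /r; field.
Qed.

(** * The gap between [g] and [U(.|x)], and the position of [h x] *)

Lemma has_derive_on_shift3 D a c1 c2 c3 x :
  has_derive_on D (fun y => c1 * (y - a) + c2 * (y - a) ^+ 2 + c3 * (y - a) ^+ 3)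
    x (c1 + 2 * c2 * (x - a) + 3 * c3 * (x - a) ^+ 2).
Proof.
apply: has_derive_on_eq (has_derive_onD (has_derive_onD
  (has_derive_onZ c1 (has_derive_onX D a 1 x))
  (has_derive_onZ c2 (has_derive_onX D a 2 x)))
  (has_derive_onZ c3 (has_derive_onX D a 3 x))) => [y|] /=; ring.
Qed.

(** The set [E] is independent of [D]: it is [D] for the gap, and a closed segment for the
    intermediate value theorem. *)
Lemma US_U_has_derive_on E D g b3 x t :
  has_derive_on E (US_U D g b3 x) t (derive_onn D 1 g x
    + (t - x) * derive_onn D 2 g x + b3 / 2 * (t - x) ^+ 2).
Proof.
apply: has_derive_on_eq (has_derive_onD (has_derive_on_cst E t (g x))
  (has_derive_on_shift3 E x (derive_onn D 1 g x) (derive_onn D 2 g x / 2)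
    (b3 / 6) t)) => [y|];
  by rewrite /US_U; field.
Qed.

Lemma US_U_same D g b3 x : US_U D g b3 x x = g x.
Proof. by rewrite /US_U subrr; ring. Qed.

(* The sign of the third derivative of the gap propagates to the second and the
   first, because both vanish at [x]. *)
Lemma US_gap_nondecreasing D g b3 x s t : is_interval D ->
  (forall y, D y -> derivable_onn D 3 g y) -> TLB_constant D g b3 ->
  D x -> D s -> D t -> s <= t ->
  g s - US_U D g b3 x s <= g t - US_U D g b3 x t.
Proof.
move=> itvD dg tlb Dx Ds Dt st.
pose dg1 := derive_onn D 1 g; pose dg2 := derive_onn D 2 g.
(* [G1] and [G2] are the first and second derivatives of the gap. *)
pose G2 y := dg2 y - (dg2 x + b3 * (y - x)).
pose G1 y := dg1 y - (dg1 x + dg2 x * (y - x) + b3 / 2 * (y - x) ^+ 2).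
have G2_sign y : D y -> 0 <= G2 y * (y - x).
  move=> Dy; have [z Dz _|c [Dc _ _]] :=
      @MVT_on _ D G2 (fun z => derive_onn D 3 g z - b3) x y itvD Dx Dy.
    apply: has_derive_on_eq (has_derive_onB (derivable_onP (dg z Dz 2%N isT).1)
      (has_derive_onD (has_derive_on_cst D z (dg2 x))
        (has_derive_onZ b3 (has_derive_onX D x 1 z)))) => [w|] /=; last ring.
    by rewrite expr1.
  rewrite {2}/G2 subrr mulr0 addr0 subrr subr0 => ->.
  by rewrite -mulrA mulr_ge0 -?expr2 ?sqr_ge0 // subr_ge0 tlb.
have G1_ge0 y : D y -> 0 <= G1 y.
  move=> Dy; have [z Dz _|c [Dc _ cxy]] := @MVT_on _ D G1 G2 x y itvD Dx Dy.
    apply: has_derive_on_eq (has_derive_onB (derivable_onP (dg z Dz 1%N isT).1)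
      (has_derive_onD (has_derive_on_cst D z (dg1 x))
        (has_derive_on_shift3 D x (dg2 x) (b3 / 2) 0 z))) => [w|] /=.
      by rewrite mul0r addr0 addrA.
    by rewrite /G2 /dg2 /derive_onn /=; field.
  rewrite {2}/G1 subrr expr0n !mulr0 !addr0 subrr subr0 => ->.
  have [->|cx] := eqVneq c x; first by rewrite /G2 subrr mulr0 addr0 subrr mul0r.
  (* Multiplying by [(c - x)^2] splits [G2 c * (y - x)] into the nonnegative factors
     [G2 c * (c - x)] and [(c - x) * (y - x)]. *)
  have cx2 : 0 < (c - x) ^+ 2 by rewrite exprn_even_gt0 // subr_eq0.
  rewrite -(pmulr_lge0 _ cx2); have := mulr_ge0 (G2_sign c Dc) cxy.
  by congr (0 <= _); ring.
have [z Dz _|c [Dc _ _]] := @MVT_on _ D (fun y => g y - US_U D g b3 x y) G1 s t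
    itvD Ds Dt.
  apply: has_derive_on_eq (has_derive_onB (derivable_onP (dg z Dz 0%N isT).1)
    (US_U_has_derive_on D D g b3 x z)) => //.
  by rewrite /G1 /dg1 /dg2 /derive_onn /=; ring.
move=> gapE; rewrite -subr_ge0 gapE; apply: mulr_ge0; first exact: G1_ge0.
by rewrite subr_ge0.
Qed.

(** A gap vanishing at both [x] and [a] is zero between them by monotonicity. There [g] is a cubic
    with leading coefficient [b3 / 6], and uniqueness of the expansion at [a], even from one side,
    gives [g'''(a) = b3]. *)
Lemma US_gap_neq0 D g b3 x a : is_interval D ->
  (forall y, D y -> derivable_onn D 3 g y) -> TLB_constant D g b3 ->
  D x -> D a -> x != a -> b3 <> derive_onn D 3 g a -> g a <> US_U D g b3 x a.
Proof.
move=> itvD dg tlb Dx Da xa b3_neq gap0; apply: b3_neq.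
pose S := [set t | Num.min x a <= t <= Num.max x a].
have itvS : is_interval S.
  move=> u v /andP[u1 _] /andP[_ v2] z /andP[uz zv].
  by apply/andP; split; [exact: le_trans uz|exact: le_trans v2].
have SD : S `<=` D.
  move=> t; rewrite /S /=.
  by case: (leP x a) => _; [exact: (itvD _ _ Dx Da)|exact: (itvD _ _ Da Dx)].
have Sx : S x by rewrite /S /= ge_min le_max lexx.
have Sa : S a by rewrite /S /= ge_min le_max lexx !orbT.
have gapx : g x - US_U D g b3 x x = 0 by rewrite US_U_same subrr.
have gapS t : S t -> g t = US_U D g b3 x t.
  move=> St; have Dt := SD _ St; apply/eqP; rewrite -subr_eq0 eq_le.
  have mono := US_gap_nondecreasing itvD dg tlb Dx.
  have gapa : g a - US_U D g b3 x a = 0 by rewrite gap0 subrr.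
  move: St; rewrite /S /=; case: (leP x a) => _ /andP[l1 l2].
    have := mono _ _ Dx Dt l1; have := mono _ _ Dt Da l2.
    by rewrite gapx gapa => -> ->.
  have := mono _ _ Da Dt l1; have := mono _ _ Dt Dx l2.
  by rewrite gapx gapa => -> ->.
pose v := a - x; pose dg1 := derive_onn D 1 g; pose dg2 := derive_onn D 2 g.
(* The coefficients are those of [U(.|x)] recentred at [a], minus the Taylor coefficients of [g] at
   [a]. *)
have [] := @little_pow3_cubic S a (dg1 x + v * dg2 x + b3 / 2 * v ^+ 2 - dg1 a)
  ((dg2 x + b3 * v - dg2 a) / 2) ((b3 - derive_onn D 3 g a) / 6).
- by move=> e e0; exact: (itv_accumulation itvS Sa Sx xa e0).
- apply: little_pow_ext (little_pow_sub SD (taylor_peano3 itvD Da (dg a Da))).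
  move=> t St; by rewrite gapS // gap0 /US_U /v /dg1 /dg2; field.
- by move=> _ _ /eqP; rewrite mulf_eq0 invr_eq0 pnatr_eq0 orbF subr_eq0 => /eqP.
Qed.

(** [U(x|x) = g x], while monotonicity of the gap and its nonvanishing at [a] give [U(a|x)] the
    opposite strict sign. The intermediate value theorem yields a zero in between, which is [h x] by
    uniqueness. *)
Lemma US_map_between D g b3 h a x : is_interval D ->
  (forall y, D y -> derivable_onn D 3 g y) -> TLB_constant D g b3 ->
  US_map D g b3 h -> D a -> b3 <> derive_onn D 3 g a -> g a = 0 ->
  (forall y, D y -> y < a -> 0 < g y) -> (forall y, D y -> a < y -> g y < 0) ->
  D x -> (x < a -> x < h x < a) /\ (a < x -> a < h x < x).
Proof.
move=> itvD dg tlb hU Da b3_neq ga0 gpos gneg Dx.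
have U_cts u w : {within `[u, w], continuous (US_U D g b3 x)}.
  apply/subspace_continuousP => t _.
  exact: has_derive_on_continuous (US_U_has_derive_on _ D g b3 x t).
have hE c : D c -> US_U D g b3 x c = 0 -> c = h x.
  by move=> Dc Uc; have : [set h x] c by rewrite -(hU _ Dx).
have mono := US_gap_nondecreasing itvD dg tlb Dx.
have Ua : x != a -> US_U D g b3 x a <> 0.
  by move=> xa Ua0; apply: (US_gap_neq0 itvD dg tlb Dx Da xa b3_neq); rewrite ga0.
split=> [xa|ax].
- have gx := gpos _ Dx xa; have {}Ua := Ua (negbT (lt_eqF xa)).
  have U_lt0 : US_U D g b3 x a < 0.
    have := mono _ _ Dx Da (ltW xa); rewrite US_U_same ga0 subrr sub0r oppr_ge0.
    by rewrite le_eqVlt => /orP[/eqP|].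
  have [|c] := IVT (v := 0) (ltW xa) (U_cts x a).
    by rewrite US_U_same ge_min le_max (ltW U_lt0) (ltW gx) orbT.
  rewrite in_itv /= => /andP[xc ca] Uc.
  rewrite -(hE c) //; last by apply: (itvD _ _ Dx Da); rewrite xc.
  rewrite !lt_neqAle xc ca !andbT; apply/andP; split; apply/eqP => cE.
    by move: Uc; rewrite -cE US_U_same => gx0; rewrite gx0 ltxx in gx.
  by rewrite -cE in Ua.
- have gx := gneg _ Dx ax; have {}Ua := Ua (negbT (gt_eqF ax)).
  have U_gt0 : 0 < US_U D g b3 x a.
    have := mono _ _ Da Dx (ltW ax); rewrite US_U_same ga0 subrr sub0r oppr_le0.
    by rewrite le_eqVlt => /orP[/eqP/esym|].
  have [|c] := IVT (v := 0) (ltW ax) (U_cts a x).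
    by rewrite US_U_same ge_min le_max (ltW U_gt0) (ltW gx) orbT.
  rewrite in_itv /= => /andP[ac cx] Uc.
  rewrite -(hE c) //; last by apply: (itvD _ _ Da Dx); rewrite ac.
  rewrite !lt_neqAle ac cx !andbT; apply/andP; split; apply/eqP => cE.
    by rewrite cE in Ua.
  by move: Uc; rewrite cE US_U_same => gx0; rewrite gx0 ltxx in gx.
Qed.

(** * Limit and rate of the iteration *)

Lemma US_iteration_limit D g b3 h (u : nat -> R) l :
  (forall y, D y -> derivable_onn D 3 g y) ->
  (forall y, D y -> US_U D g b3 y (h y) = 0) ->
  (forall t, D (u t)) -> (forall t, u t.+1 = h (u t)) ->
  u t @[t --> \oo] --> l -> D l -> g l = 0.
Proof.
move=> dg Uh Du uS ul Dl.
(* The derivatives are continuous only relative to [D], so the convergence is recorded inside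
   [D]. *)
have u_within : u @ \oo --> within D (nbhs l).
  by move=> P /ul; apply: (@filterS _ \oo) => t /(_ (Du t)).
have dcvg k : (k < 3)%N -> derive_onn D k g (u t) @[t --> \oo] --> derive_onn D k g l.
  move=> k3; apply: cvg_comp u_within _.
  exact: has_derive_on_continuous (derivable_onP (dg l Dl k k3).1).
have uSl : u t.+1 @[t --> \oo] --> l by rewrite -cvg_shiftS in ul.
have step0 : u t.+1 - u t @[t --> \oo] --> 0 by rewrite -(subrr l); exact: cvgB.
(* Both arguments of [U] tend to [l], so its values, all zero, tend to [g l]. *)
have : US_U D g b3 (u t) (u t.+1) @[t --> \oo] -->
    g l + 0 * derive_onn D 1 g l + 0 * 0 / 2 * derive_onn D 2 g l
    + b3 / 6 * (0 * (0 * 0)).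
  apply: cvgD; last by apply: cvgM (cvg_cst _) (cvgM step0 (cvgM step0 step0)).
  apply: cvgD; last first.
    by apply: cvgM (cvgM (cvgM step0 step0) (cvg_cst _)) (dcvg 2%N isT).
  by apply: cvgD (cvgM step0 (dcvg 1%N isT)); exact: (dcvg 0%N isT).
have -> : (fun t => US_U D g b3 (u t) (u t.+1)) = fun=> 0.
  by apply/funext => t; rewrite uS Uh.
rewrite !mul0r !mulr0 !addr0 => U0.
by apply: (cvg_unique _ U0); [exact: norm_hausdorff|exact: cvg_cst].
Qed.

(** The expansion is evaluated along [u] and divided by [|u t - a|^3], which is nonzero since the
    orbit avoids [a]. *)
Lemma cubic_rate D h a c (u : nat -> R) :
  little_pow D a 3 (fun x => h x - a - c * (x - a) ^+ 3) ->
  (forall t, D (u t)) -> (forall t, u t != a) -> (forall t, u t.+1 = h (u t)) ->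
  u t @[t --> \oo] --> a ->
  `|u t.+1 - a| / `|u t - a| ^+ 3 @[t --> \oo] --> `|c|.
Proof.
move=> oh Du ua uS ul; apply/cvgrPdist_le => e e0.
apply: (@filterS _ \oo _ _ _ _ (ul _ (oh e e0))) => t /= /(_ (Du t)) ht.
have e3 : 0 < `|u t - a| ^+ 3 by rewrite exprn_gt0 // normr_gt0 subr_eq0 ua.
have -> : `|c| = `|c * (u t - a) ^+ 3| / `|u t - a| ^+ 3.
  by rewrite normrM normrX mulfK ?gt_eqF.
rewrite -mulrBl normrM normfV (gtr0_norm e3) ler_pdivrMr // distrC uS.
exact: le_trans (ler_dist_dist _ _) ht.
Qed.

(** Applied to the Taylor coefficients of [h], this identifies its third derivative without
    differentiating the implicit equation. *)
Lemma little_pow3_uniq D h a c c1 c2 c3 :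
  (forall e, 0 < e -> exists2 x, D x /\ x != a & `|x - a| < e) ->
  little_pow D a 3 (fun x => h x - a - c * (x - a) ^+ 3) ->
  little_pow D a 3 (fun x => h x - (a + c1 * (x - a) + c2 * (x - a) ^+ 2
    + c3 * (x - a) ^+ 3)) -> c3 = c.
Proof.
move=> acc oc o3; have [] := little_pow3_cubic (c1 := c1) (c2 := c2)
  (c3 := c3 - c) acc.
  by apply: little_pow_ext (little_powB oc o3) => x _; ring.
by move=> _ _ /eqP; rewrite subr_eq0 => /eqP.
Qed.

End USMap.

(** * Monotone convergence of the iterates and the value of the limiting ratio *)

Theorem theorem4 (R : realType) (Theta : set R) (g : R -> R) (thetas : R)
    (b3 : R) (h : R -> R) (theta : nat -> R)
    (Theta_itv : is_interval Theta)
    (g_derivable : forall x : R, Theta x -> derivable_onn Theta 3 g x)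
    (g_root : [set x | Theta x /\ g x = 0] = [set thetas])
    (g_pos : forall x : R, Theta x -> x < thetas -> 0 < g x)
    (g_neg : forall x : R, Theta x -> thetas < x -> g x < 0)
    (b3_TLB : TLB_constant Theta g b3)
    (h_US : US_map Theta g b3 h)
    (theta_init : Theta (theta 0%N))
    (theta_step : forall t : nat, theta t.+1 = h (theta t))
    (theta_neq : theta 0%N <> thetas)
    (g'_neq0 : derive_onn Theta 1 g thetas <> 0)
    (b3_neq : b3 <> derive_onn Theta 3 g thetas) :
  let c := `|(b3 - derive_onn Theta 3 g thetas)
             / (6 * derive_onn Theta 1 g thetas)| in
  [/\ cubic_convergence theta thetas c,
      (derivable_onn Theta 3 h thetas ->
         `|derive_onn Theta 3 h thetas| / 6 = c)
    & 0 < c].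
Proof.
have [Da ga0] : [set x | Theta x /\ g x = 0] thetas by rewrite g_root.
have between x := @US_map_between _ Theta g b3 h thetas x Theta_itv g_derivable
  b3_TLB h_US Da b3_neq ga0 g_pos g_neg.
have hP x : Theta x -> Theta (h x) /\ US_U Theta g b3 x (h x) = 0.
  by move=> Dx; have : [set h x] (h x) by []; rewrite -(h_US _ Dx).
(* [U(thetas|thetas) = g thetas = 0], and the zero is unique. *)
have h_fix : h thetas = thetas.
  have : [set y | Theta y /\ US_U Theta g b3 thetas y = 0] thetas.
    by rewrite /= US_U_same.
  by rewrite h_US.
have h_dist x : Theta x ->
    `|h x - thetas| <= `|x - thetas| /\ `|h x - x| <= `|x - thetas|.
  move=> Dx; have [lo hi] := between x Dx.
  have [xa|ax|->] := ltgtP x thetas; last by rewrite h_fix subrr.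
    have /andP[h1 h2] := lo xa.
    rewrite !(ltr0_norm (x := _ - thetas)) ?(gtr0_norm (x := h x - x)); lra.
  have /andP[h1 h2] := hi ax.
  rewrite !(gtr0_norm (x := _ - thetas)) ?(ltr0_norm (x := h x - x)); lra.
have expansion := US_map_expansion Theta_itv Da (g_derivable _ Da) ga0
  (introN eqP g'_neq0) (fun x Dx => (hP x Dx).2) (fun x Dx => (h_dist x Dx).1)
  (fun x Dx => (h_dist x Dx).2).
have D_theta t : Theta (theta t).
  by elim: t => [//|t IH]; rewrite theta_step; exact: (hP _ IH).1.
have cvg_to l : theta t @[t --> \oo] --> l -> Theta l -> l = thetas.
  move=> tl Dl; have : [set x | Theta x /\ g x = 0] l; last by rewrite g_root.
  split=> //; exact: (US_iteration_limit g_derivable (fun x Dx => (hP x Dx).2)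
    D_theta theta_step tl Dl).
have [theta_neqs theta_cvg] : (forall t, theta t != thetas) /\
    theta t @[t --> \oo] --> thetas.
  (* The iterates stay strictly on the side of the initial value, so they avoid [thetas] and form a
     bounded monotone sequence. *)
  have [lt0|gt0|//] := ltgtP (theta 0%N) thetas.
  - have lt t : theta t < thetas.
      elim: t => [//|t IH]; rewrite theta_step.
      by have /andP[] := (between _ (D_theta t)).1 IH.
    split=> [t|]; first by rewrite lt_eqF.
    have mono : {homo theta : n m / (n <= m)%N >-> n <= m}.
      apply/nondecreasing_seqP => t; rewrite theta_step ltW //.
      by have /andP[] := (between _ (D_theta t)).1 (lt t).
    have cv : cvgn theta.
      apply: nondecreasing_is_cvgn mono _; exists thetas => _ [t _ <-].
      exact/ltW.
    rewrite -[X in _ --> X](cvg_to (limn theta)) //.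
    (* [Theta] may fail to be closed; the limit belongs to it because it lies between [theta 0] and
       [thetas]. *)
    apply: (Theta_itv _ _ theta_init Da); rewrite (nondecreasing_cvgn_le mono cv).
    by apply: limr_le => //; apply: nearW => t; exact: ltW.
  - have gt t : thetas < theta t.
      elim: t => [//|t IH]; rewrite theta_step.
      by have /andP[] := (between _ (D_theta t)).2 IH.
    split=> [t|]; first by rewrite gt_eqF.
    have mono : {homo theta : n m / (n <= m)%N >-> m <= n}.
      apply/nonincreasing_seqP => t; rewrite theta_step ltW //.
      by have /andP[] := (between _ (D_theta t)).2 (gt t).
    have cv : cvgn theta.
      apply: nonincreasing_is_cvgn mono _; exists thetas => _ [t _ <-].
      exact/ltW.
    rewrite -[X in _ --> X](cvg_to (limn theta)) //.
    apply: (Theta_itv _ _ Da theta_init).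
    rewrite (nonincreasing_cvgn_ge mono cv) andbT.
    by apply: limr_ge => //; apply: nearW => t; exact: ltW.
move=> c; split.
- split=> //; exact: cubic_rate expansion D_theta theta_neqs theta_step theta_cvg.
(* If [h'''] exists at [thetas], the Taylor expansion of [h] there must have the cubic coefficient
   found in [expansion]. *)
- move=> dh; have oh := taylor_peano3 Theta_itv Da dh; rewrite h_fix in oh.
  have acc e := itv_accumulation (e := e) Theta_itv Da theta_init
    (theta_neqs 0%N).
  by rewrite /c -(little_pow3_uniq acc expansion oh) normf_div [`|6|]ger0_norm.
- rewrite normr_gt0 mulf_neq0 ?invr_eq0 ?mulf_neq0 ?subr_eq0 //; exact/eqP.
Qed.
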